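(* For the $k$-nearest neighbour model on a Poisson point process in $\mathbb{R}^2$, the critical value satisfies \[k_c(2) \leq 188.\]
   Context: Let $S$ be the point set of a homogeneous Poisson point process of intensity $\lambda>0$ in $\mathbb{R}^2$. The $k$-nearest neighbour graph $\mathrm{NN}(2,k)$ on $S$ is the undirected graph with vertex set $S$ in which, for each $x\in S$, an edge is placed between $x$ and each of the $k$ points of $S\setminus\{x\}$ nearest to $x$ in Euclidean distance. The critical value $k_c(2)$ is the value (depending only on the dimension) such that for $k>k_c(2)$ the graph $\mathrm{NN}(2,k)$ almost surely has an infinite connected component (infinite cluster). *)

(* Defs.v *)
From HB Require Import structures.
From Stdlib Require Import Relations.Relation_Operators.
From mathcomp Require Import all_boot all_order all_algebra.
From mathcomp Require Import all_classical all_reals all_analysis.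

Set Implicit Arguments.
Unset Strict Implicit.
Unset Printing Implicit Defensive.
Import Order.TTheory GRing.Theory Num.Theory.
Local Open Scope classical_set_scope.
Local Open Scope ring_scope.

Section nn_percolation.
Variable R : realType.

Definition pt := (R * R)%type.

Definition edist (x y : pt) : R :=
  Num.sqrt ((x.1 - y.1) ^+ 2 + (x.2 - y.2) ^+ 2).

Definition leb2 : set pt -> \bar R :=
  ((@lebesgue_measure R) \x (@lebesgue_measure R))%E.

Definition bounded2 (A : set pt) : Prop :=
  exists r : R, A `<=` [set x | `|x.1| <= r /\ `|x.2| <= r].

Definition has_card (A : set pt) (n : nat) : Prop :=
  exists s : seq pt, [/\ uniq s, size s = n & A = [set z | z \in s]].

Definition card_lt (A : set pt) (k : nat) : Prop :=
  exists s : seq pt, (size s < k)%N /\ A `<=` [set z | z \in s].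

(** Poisson probability mass function with mean [mu >= 0]
    (with the convention 0^0 = 1, so mean 0 gives the Dirac mass at 0). *)
Definition pois (mu : R) (n : nat) : R := mu ^+ n / n`!%:R * expR (- mu).

Definition count_event (Omega : Type) (S : Omega -> set pt) (A : set pt)
  (n : nat) : set Omega := [set w | has_card (S w `&` A) n].

Definition poisson_pp (d : measure_display) (Omega : measurableType d)
  (P : probability Omega R) (lam : R) (S : Omega -> set pt) : Prop :=
  (forall (A : set pt) (n : nat), measurable A -> bounded2 A ->
      measurable (count_event S A n) /\
      P (count_event S A n) = (pois (lam * fine (leb2 A)) n)%:E) /\
  (forall (m : nat) (A : 'I_m -> set pt) (n : 'I_m -> nat),
      (forall i, measurable (A i)) -> (forall i, bounded2 (A i)) ->
      (forall i j, i != j -> A i `&` A j = set0) ->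
      fine (P [set w | forall i, count_event S (A i) (n i) w]) =
      \prod_(i < m) fine (P (count_event S (A i) (n i)))).

(** [y] is one of the [k] nearest points of [S \ {x}] to [x]:
    fewer than [k] points of [S \ {x}] are strictly closer to [x] than [y]
    (a.s. all distances are distinct, so this selects exactly k points). *)
Definition knear (S : set pt) (k : nat) (x y : pt) : Prop :=
  S y /\ y <> x /\
  card_lt [set z | S z /\ z <> x /\ edist x z < edist x y] k.

Definition nn_edge (S : set pt) (k : nat) (x y : pt) : Prop :=
  S x /\ S y /\ (knear S k x y \/ knear S k y x).

Definition has_infinite_cluster (S : set pt) (k : nat) : Prop :=
  exists x : pt, S x /\
    infinite_set [set y | clos_refl_trans pt (nn_edge S k) x y].

End nn_percolation.

(* Main.v *)
(* A Peierls argument after renormalisation. Cut the quadrant into tiles of side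
   [a] with [lam * a ^+ 2 = 11 / 4] and call a tile good if its concentric core
   of side [0.87 a] is occupied and the 5 x 5 block of tiles around it holds at
   most 188 points. Core points of two adjacent tiles are closer than the
   distance from a core to the complement of its block, so core points of
   adjacent good tiles are joined in NN(2, 189), and an infinite cluster of good
   tiles suffices. If there is none, then for arbitrarily large [r] a shortest
   king path of bad tiles starts at [(r, 0)] and reaches the opposite axis.
   Such a path is chordless, hence has at most 5 continuations at each step.
   A bad tile is empty or overcrowded; bounding the indicator of overcrowding by
   [expR ((B - 189) / 25)], where [B] is the block count, and using that a tile
   lies in at most 25 blocks, [n] given distinct tiles are all bad with
   probability at most [w ^+ n], where
   [w = expR (- 11 / 4 * 0.87 ^ 2) + expR (11 / 4 * (e - 1) - 189 / 25) < 1 / 5].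
   Borel-Cantelli concludes. *)
Require Import Defs.
From HB Require Import structures.
From Stdlib Require Import Relations.Relation_Operators.
From mathcomp Require Import all_boot all_order all_algebra.
From mathcomp Require Import all_classical all_reals all_analysis.
From mathcomp Require Import zify lra ring.
Import Order.TTheory GRing.Theory Num.Theory.
Local Open Scope classical_set_scope.
Local Open Scope ring_scope.

(** * Paths and boundaries in the quadrant lattice *)

Section lattice.
Local Open Scope nat_scope.

Definition site := (nat * nat)%type.

(** King moves, with staying put allowed: reflexivity later turns a repeated site into a chord. *)
Definition adj8 (u v : site) : bool :=
  [&& u.1 <= v.1.+1, v.1 <= u.1.+1, u.2 <= v.2.+1 & v.2 <= u.2.+1].

Definition adj4 (u v : site) : bool :=
  (u.1 == v.1) && ((u.2 == v.2.+1) || (v.2 == u.2.+1)) ||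
  (u.2 == v.2) && ((u.1 == v.1.+1) || (v.1 == u.1.+1)).

Definition walk (e : rel site) (B : pred site) (n : nat) (p : nat -> site) :=
  (forall i, i < n -> e (p i) (p i.+1)) /\ (forall i, i <= n -> B (p i)).

Definition joined (e : rel site) (B : pred site) (u v : site) :=
  exists n p, [/\ walk e B n p, p 0 = u & p n = v].

Lemma joined_refl e (B : pred site) u : B u -> joined e B u u.
Proof. by move=> Bu; exists 0, (fun=> u); split=> //; split. Qed.

Lemma joined_step e (B : pred site) u v w :
  joined e B u v -> e v w -> B w -> joined e B u w.
Proof.
move=> [n [p [[ep Bp] p0 pn]]] evw Bw.
exists n.+1, (fun i => if i <= n then p i else w); split; last 1 first.
- by rewrite ltnn.
- split=> i.
  + rewrite ltnS => lein; rewrite lein; case: ltnP => [ltin|leni].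
      exact: ep.
    have -> : i = n by apply/eqP; rewrite eqn_leq lein.
    by rewrite pn.
  + by case: ifP => // + _; exact: Bp.
- by rewrite leq0n.
Qed.

Lemma joined_tgt e (B : pred site) u v : joined e B u v -> B v.
Proof. by move=> [n [p [[_ Bp] _ <-]]]; exact: Bp. Qed.

Section boundary.
Variables (C : pred site) (N : nat).
Hypothesis boundC : forall v, C v -> v.1 < N /\ v.2 < N.
Hypothesis C0 : C (0, 0).
Hypothesis connC : forall v, C v -> joined adj4 C (0, 0) v.

Definition bdry : pred site :=
  fun v => ~~ C v && `[< exists2 u, C u & adj4 u v >].

(* If the king-component [K] of [(r, 0)] in the boundary avoided the column
   [x = 0], the edges joining [C] to [K] would form a closed 1-form modulo 2;
   its primitive [g] vanishes on [C], on that column and far away, although the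
   edge from [(r.-1, 0)] to [(r, 0)] is crossed once. *)
Lemma boundary_reaches_axis (r : nat) : 0 < r -> C (r.-1, 0) ->
  (forall x, r <= x -> ~~ C (x, 0)) ->
  exists2 v, joined adj8 bdry (r, 0) v & v.1 = 0.
Proof.
move=> r0 Cr nCr; apply: contrapT => noK.
pose K : pred site := fun v => `[< joined adj8 bdry (r, 0) v >].
have KC v : K v -> ~~ C v by move=> /asboolP /joined_tgt /andP[].
have K0 y : ~~ K (0, y) by apply/negP => /asboolP Ky; apply: noK; exists (0, y).
have Kprop u v w : C u -> ~~ C v -> adj4 u v -> K w -> adj8 w v -> K v.
  move=> Cu nCv uv /asboolP Kw wv; apply/asboolP.
  by apply: joined_step Kw wv _; rewrite /bdry nCv /=; apply/asboolP; exists u.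
have Kr : K (r, 0).
  apply/asboolP/joined_refl; rewrite /bdry nCr //=; apply/asboolP.
  by exists (r.-1, 0) => //; rewrite /adj4 /= prednK // eqxx !orbT.
pose f u v := (C u && K v) || (K u && C v).
(* Closedness on a unit square: its corners are king neighbours, so once one corner is in [K], each
   side leaving [C] ends in [K]. Then [f] marks the changes of membership in [C] around the square,
   which are even in number. *)
have fcycle x y : f (x, y) (x.+1, y) (+) f (x.+1, y) (x.+1, y.+1) =
    f (x, y) (x, y.+1) (+) f (x, y.+1) (x.+1, y.+1).
  have nearby (u v : site) : x <= u.1 <= x.+1 -> y <= u.2 <= y.+1 ->
    x <= v.1 <= x.+1 -> y <= v.2 <= y.+1 -> adj8 u v by rewrite /adj8; lia.
  have P (u v w : site) : x <= w.1 <= x.+1 -> y <= w.2 <= y.+1 ->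
      x <= v.1 <= x.+1 -> y <= v.2 <= y.+1 -> adj4 u v ->
      [==> C u, ~~ C v, K w => K v].
    move=> w1 w2 v1 v2 uv; apply/implyP => Cu; apply/implyP => nCv.
    by apply/implyP => Kw; apply: Kprop Cu nCv uv Kw _; apply: nearby.
  set a := (x, y); set b := (x.+1, y); set c := (x, y.+1); set d := (x.+1, y.+1).
  have D u v : adj4 u v -> u \in [:: a; b; c; d] -> v \in [:: a; b; c; d] ->
      forall w, w \in [:: a; b; c; d] ->
      [==> C u, ~~ C v, K w => K v] /\ [==> C v, ~~ C u, K w => K u].
    have In w : w \in [:: a; b; c; d] -> (x <= w.1 <= x.+1) /\ (y <= w.2 <= y.+1).
      by rewrite !inE => /or4P[] /eqP -> /=; lia.
    move=> uv /In[u1 u2] /In[v1 v2] w /In[w1 w2]; split; apply: P => //.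
    by move: uv; rewrite /adj4; lia.
  have ab : adj4 a b by rewrite /adj4 /=; lia.
  have ac : adj4 a c by rewrite /adj4 /=; lia.
  have bd : adj4 b d by rewrite /adj4 /=; lia.
  have cd : adj4 c d by rewrite /adj4 /=; lia.
  have ia : a \in [:: a; b; c; d] by rewrite !inE eqxx.
  have ib : b \in [:: a; b; c; d] by rewrite !inE eqxx !orbT.
  have ic : c \in [:: a; b; c; d] by rewrite !inE eqxx !orbT.
  have id : d \in [:: a; b; c; d] by rewrite !inE eqxx !orbT.
  have kc w : K w ==> ~~ C w by apply/implyP/KC.
  have := kc a; have := kc b; have := kc c; have := kc d.
  have := D _ _ ab ia ib _ ic; have := D _ _ ab ia ib _ id.
  have := D _ _ ac ia ic _ ib; have := D _ _ ac ia ic _ id.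
  have := D _ _ bd ib id _ ia; have := D _ _ bd ib id _ ic.
  have := D _ _ cd ic id _ ia; have := D _ _ cd ic id _ ib.
  have := D _ _ ab ia ib _ ia; have := D _ _ ab ia ib _ ib.
  have := D _ _ ac ia ic _ ia; have := D _ _ ac ia ic _ ic.
  have := D _ _ bd ib id _ ib; have := D _ _ bd ib id _ id.
  have := D _ _ cd ic id _ ic; have := D _ _ cd ic id _ id.
  rewrite /f; case: (C a); case: (C b); case: (C c); case: (C d);
  case: (K a) => //=; case: (K b) => //=; case: (K c) => //=; case: (K d) => //=;
  by intuition.
pose g x y := \big[addb/false]_(i < x) f (i : nat, y) (i.+1, y).
have gS x y : g x.+1 y = g x y (+) f (x, y) (x.+1, y).
  by rewrite /g big_ord_recr.
have gV x y : g x y.+1 = g x y (+) f (x, y) (x, y.+1).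
  elim: x => [|x IH]; last by rewrite !gS IH -!addbA -fcycle.
  by rewrite /g !big_ord0 /f (negbTE (K0 _)) (negbTE (K0 _)) andbF.
have nC u : (N <= u.1) || (N <= u.2) -> C u = false.
  by move=> Nu; apply/negP => /boundC; lia.
have f0 u v : C u = false -> C v = false -> f u v = false.
  by rewrite /f => -> ->; rewrite andbF.
have g_top x : g x N = false.
  elim: x => [|x IH]; first by rewrite /g big_ord0.
  by rewrite gS IH f0 // nC //= leqnn orbT.
have g_right y : y <= N -> g N y = false.
  move=> yN; rewrite -(subKn yN); elim: (N - y) => [|k IH].
    by rewrite subn0 g_top.
  have [kN|Nk] := ltnP k N; last by have -> : N - k.+1 = N - k by lia.
  move: IH; rewrite (_ : N - k = (N - k.+1).+1); last by lia.
  by rewrite gV (f0 (N, _)) ?nC /= ?leqnn ?addbF.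
(* [f] vanishes between sites of [C], so along a walk in [C] the function [g] keeps its value at the
   origin. *)
have g_C v : C v -> g v.1 v.2 = false.
  move=> /connC [n [p [[ep Cp] p0 <-]]].
  suff: forall i, i <= n -> g (p i).1 (p i).2 = false by exact.
  elim=> [_|i IH ltin]; first by rewrite p0 /g big_ord0.
  have := IH (ltnW ltin); have := ep i ltin.
  have := Cp i (ltnW ltin); have := Cp _ ltin.
  case: (p i) (p i.+1) => [x y] [x' y'] /= C1 C2.
  have fC u w : C u -> C w -> f u w = false.
    move=> Cu Cw; rewrite /f; case: (boolP (K u)) => [/KC|]; first by rewrite Cu.
    by case: (boolP (K w)) => [/KC|]; [rewrite Cw|rewrite andbF].
  rewrite /adj4 /= => /orP[] /andP[/eqP ?] /orP[] /eqP ?; subst.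
  - by rewrite gV fC // addbF.
  - by rewrite gV fC // addbF.
  - by rewrite gS fC // addbF.
  - by rewrite gS fC // addbF.
have g_r : g r 0 = true.
  rewrite -(prednK r0) gS (g_C _ Cr) prednK // /f Cr Kr //.
have rN : r <= N by have [] := boundC _ Cr; rewrite /=; lia.
(* From column [r] on the axis misses [C], so [g] stays true up to column [N], against [g_right]. *)
have : g N 0 = true.
  rewrite -(subnKC rN); elim: (N - r) => [|k IH]; first by rewrite addn0.
  by rewrite addnS gS IH f0 //; apply/negbTE/nCr; lia.
by rewrite g_right.
Qed.

End boundary.

(** Induction on the length: a walk that meets [T] early is cut there, and one with a chord takes
    the chord; either way it gets shorter. *)
Lemma chordless_walk (e : rel site) (B T : pred site) n p :
  walk e B n p -> T (p n) ->
  exists m q, [/\ walk e B m q, q 0 = p 0, T (q m),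
    (forall i, i < m -> ~~ T (q i)) &
    (forall i j, i.+1 < j <= m -> ~~ e (q i) (q j))].
Proof.
elim/ltn_ind: n p => n IH p wp Tp; have [ep Bp] := wp.
have [[i ltin Ti]|noT] := EM (exists2 i, i < n & T (p i)).
  apply: IH Ti => //; split=> j ji; [apply: ep|apply: Bp]; lia.
have [[i [j [ijn eij]]]|noe] :=
    EM (exists i j, i.+1 < j <= n /\ e (p i) (p j)).
  have [|||m [q [wq q0 Tq nT ne]]] := IH (n - (j - i.+1)) _
      (fun k => if k <= i then p k else p (k + (j - i.+1))).
  - lia.
  - split=> k kn /=; last by case: ifP => ki; apply: Bp; lia.
    have [ki|ki] := leqP k i; last first.
      have -> : (k < i) = false by lia.
      by rewrite /= addSn; apply: ep; lia.
    case: (leqP k.+1 i) => ki'; first by apply: ep; lia.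
    have -> : k = i by lia.
    by have -> : i.+1 + (j - i.+1) = j by lia.
  - have -> : (n - (j - i.+1) <= i) = false by lia.
    by rewrite /= subnK //; lia.
  - by exists m, q; split=> //; rewrite q0 leq0n.
exists n, p; split=> //.
- by move=> i ltin; apply/negP => Ti; apply: noT; exists i.
- by move=> i j ijn; apply/negP => eij; apply: noe; exists i, j.
Qed.

(* Only the king moves from [b] which lead away from [a] can prolong a
   chordless path ending with the step from [a] to [b]. *)
Definition next_sites (a b : site) : seq site :=
  let x := b.1.*2 - a.1 in let y := b.2.*2 - a.2 in
  if b.1 == a.1 then [:: (b.1.-1, y); (b.1, y); (b.1.+1, y)]
  else if b.2 == a.2 then [:: (x, b.2.-1); (x, b.2); (x, b.2.+1)]
  else [:: (x, y); (x, b.2); (x, a.2); (b.1, y); (a.1, y)].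

Lemma size_next_sites a b : size (next_sites a b) <= 5.
Proof. by rewrite /next_sites; do 2?[case: ifP]. Qed.

(** Truncated subtraction is harmless: a candidate outside the quadrant only yields a spurious extra
    entry. *)
Lemma mem_next_sites a b z :
  adj8 a b -> adj8 b z -> ~~ adj8 a z -> z \in next_sites a b.
Proof.
case: a b z => [a1 a2] [b1 b2] [z1 z2]; rewrite /adj8 /next_sites /=.
case: eqP => ?; [|case: eqP => ?]; rewrite !inE !xpair_eqE; lia.
Qed.

Fixpoint prolongations (n : nat) (a b : site) : seq (seq site) :=
  if n is n'.+1 then
    flatten [seq [seq z :: w | w <- prolongations n' b z] | z <- next_sites a b]
  else [:: [::]].

Lemma size_flatten_leq (T : eqType) (ss : seq (seq T)) m k :
  all (fun s => size s <= k) ss -> size ss <= m -> size (flatten ss) <= m * k.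
Proof.
move=> /allP sk sm; apply: leq_trans (leq_mul sm (leqnn k)).
rewrite size_flatten /shape sumnE big_map mulnC -sum1_size big_distrr /=.
rewrite big_seq [leqRHS]big_seq; apply: leq_sum => s /sk; lia.
Qed.

Lemma size_prolongations n a b : size (prolongations n a b) <= 5 ^ n.
Proof.
elim: n a b => [//|n IH] a b; rewrite expnS.
apply: size_flatten_leq; last by rewrite size_map size_next_sites.
by apply/allP => s /mapP[z _ ->]; rewrite size_map IH.
Qed.

(** Chordlessness enters only through sites two steps apart, which already cuts the continuations
    down to five. *)
Lemma mem_prolongations n i (p : nat -> site) :
  (forall j, j < i + n.+1 -> adj8 (p j) (p j.+1)) ->
  (forall j, j.+1 < i + n.+1 -> ~~ adj8 (p j) (p j.+2)) ->
  [seq p j | j <- iota i.+2 n] \in prolongations n (p i) (p i.+1).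
Proof.
elim: n i => [//|n IH] i ep np /=.
apply/flattenP; exists [seq p i.+2 :: w | w <- prolongations n (p i.+1) (p i.+2)].
  apply/mapP; exists (p i.+2) => //.
  by apply: mem_next_sites; [apply: ep|apply: ep|apply: np]; lia.
apply/mapP; exists [seq p j | j <- iota i.+3 n] => //.
by apply: IH => j ji; [apply: ep|apply: np]; lia.
Qed.

(** For positive [r], the first [r + 1] sites of a path to the axis are recorded. The six candidates
    for the second site are [(r, 0)] itself and its king neighbours in the quadrant. *)
Definition axis_walks (r : nat) : seq (seq site) :=
  flatten [seq [seq (r, 0) :: z :: w | w <- prolongations r.-1 (r, 0) z] |
    z <- [seq (x, y) | x <- [:: r.-1; r; r.+1], y <- [:: 0; 1]]].

Lemma size_axis_walks r : size (axis_walks r) <= 6 * 5 ^ r.-1.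
Proof.
apply: size_flatten_leq => //.
by apply/allP => s /mapP[z _ ->]; rewrite size_map size_prolongations.
Qed.

Lemma size_mem_axis_walks r g : 0 < r -> g \in axis_walks r -> size g = r.+1.
Proof.
have sz n a b w : w \in prolongations n a b -> size w = n.
  elim: n a b w => [|n IH] a b w /=; first by rewrite inE => /eqP ->.
  by move=> /flattenP[s /mapP[z _ ->] /mapP[w' /IH <- ->]].
by move=> r0 /flattenP[s /mapP[z _ ->] /mapP[w /sz sw ->]]; rewrite /= sw prednK.
Qed.

(** The first coordinate drops by at most one per step, so the path has at least [r] steps and can
    be cut to [r + 1] sites. *)
Lemma chordless_axis_walk r (p : nat -> site) (B : pred site) m : 0 < r ->
  p 0 = (r, 0) -> walk adj8 B m p -> (p m).1 = 0 ->
  (forall i, i < m -> (p i).1 != 0) ->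
  (forall i j, i.+1 < j <= m -> ~~ adj8 (p i) (p j)) ->
  exists g, [/\ g \in axis_walks r, uniq g & all B g].
Proof.
move=> r0 p0 [ep Bp] pm npT ne.
have rm : r <= m.
  suff: forall i, i <= m -> r <= (p i).1 + i by move=> /(_ m (leqnn m)); rewrite pm.
  elim=> [|i IH] im; first by rewrite p0 addn0.
  have := IH (ltnW im); have := ep i im; rewrite /adj8; lia.
exists [seq p j | j <- iota 0 r.+1]; split.
- case: r r0 p0 rm => // r _ p0 rm /=.
  apply/flattenP; exists [seq (r.+1, 0) :: p 1 :: w | w <- prolongations r (r.+1, 0) (p 1)].
    apply/mapP; exists (p 1) => //; apply/allpairsP.
    have := ep 0 (leq_trans (ltn0Sn _) rm); rewrite p0.
    case: (p 1) => x y; rewrite /adj8 /= => xy; exists (x, y) => /=.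
    by rewrite !inE; split=> //; lia.
  apply/mapP; exists [seq p j | j <- iota 2 r]; last by rewrite p0.
  rewrite -p0; apply: mem_prolongations => j jr; first by apply: ep; lia.
  by apply: ne; lia.
- rewrite map_inj_in_uniq ?iota_uniq // => i j; rewrite !mem_iota /= !add0n => ir jr.
  wlog ij : i j ir jr / i <= j.
    by move=> W pij; have [|/ltnW] := leqP i j => H; [|symmetry]; apply: W.
  move=> pij; apply/eqP; rewrite eqn_leq ij leqNgt /=; apply/negP => ltij.
  have adjr u : adj8 u u by rewrite /adj8; lia.
  (* A repeat at distance at least two is a chord. If [p i = p i.+1], then [p i] is joined to
     [p i.+2], again a chord, unless [i.+1 = m], when the axis was met too early. *)
  have [lt|] := ltnP i.+1 j; first by have := ne i j; rewrite pij adjr; lia.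
  move=> ji; have {ji ltij ij} ej : j = i.+1 by lia.
  subst j; have [jm|mj] := ltnP i.+1 m.
    by have := ne i i.+2; rewrite pij ep // ltnSn jm => /(_ isT).
  have mi : m = i.+1 by lia.
  by have := npT i; rewrite pij -mi pm mi ltnSn => /(_ isT).
- apply/allP => v /mapP[j]; rewrite mem_iota => jr ->; apply: Bp; lia.
Qed.

(** * Finite good clusters and the Peierls argument *)

Lemma finite_set_site_bound (A : set site) : finite_set A ->
  exists N, forall v, A v -> v.1 < N /\ v.2 < N.
Proof.
move=> /finite_seqP[s ->]; set M := \max_(v <- s) (v.1 + v.2).
exists M.+1 => v /= vs; have : v.1 + v.2 <= M.
  exact: (@leq_bigmax_seq _ s xpredT (fun u : site => u.1 + u.2) v vs isT).
by move: M => M; lia.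
Qed.

Lemma peierls (good : pred site) :
  (forall v, finite_set [set u | joined adj4 good v u]) ->
  forall R0, exists r, [/\ R0 < r & exists g,
    [/\ g \in axis_walks r, uniq g & all (predC good) g]].
Proof.
move=> fin R0.
(* The segment seeds the cluster: it makes [C] nonempty and carries it at least to [(R0, 0)],
   whatever the good sites are. *)
pose seg : pred site := fun u => (u.2 == 0) && (u.1 <= R0).
pose good' : pred site := fun u => good u || seg u.
pose C : pred site := fun u => `[< joined adj4 good' (0, 0) u >].
have C0 : C (0, 0) by apply/asboolP/joined_refl; rewrite /good' /seg /= orbT.
have Cgood u : C u -> good' u by move=> /asboolP/joined_tgt.
have Cstep u v : C u -> adj4 u v -> good' v -> C v.
  by move=> /asboolP Cu uv gv; apply/asboolP; exact: joined_step Cu uv gv.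
have Cseg x : x <= R0 -> C (x, 0).
  elim: x => // x IH xR; apply: (Cstep (x, 0)); first by apply: IH; lia.
    by rewrite /adj4 /=; lia.
  by rewrite /good' /seg /= xR orbT.
have connC v : C v -> joined adj4 C (0, 0) v.
  move=> /asboolP[n [p [[ep gp] p0 pn]]]; exists n, p; split=> //; split=> // i lein.
  apply/asboolP; exists i, p; split=> //; split=> j ji; [apply: ep|apply: gp]; lia.
have [N boundC] : exists N, forall v, C v -> v.1 < N /\ v.2 < N.
  apply: (@finite_set_site_bound [set v | C v]).
  (* Holds the segment and its neighbours, so every site of [C] is in it or in the good cluster of
     one of its sites. *)
  pose near : set site := `I_R0.+2 `*` `I_2.
  apply: (@sub_finite_set _ _
    (near `|` \bigcup_(v in near) [set u | joined adj4 good v u])).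
    move=> u /= /asboolP[n [p [[ep gp] p0 <-]]].
    suff: forall i, i <= n -> seg (p i) \/
        exists2 v, near v & joined adj4 good v (p i).
      move=> /(_ n (leqnn n))[sp|[v nv jv]]; [left|by right; exists v].
      by move: sp; rewrite /near /seg /=; lia.
    elim=> [_|i IH ltin]; first by left; rewrite p0.
    have := gp _ ltin; rewrite /good' => /orP[gi|]; last by left.
    right; have [sp|[v nv jv]] := IH (ltnW ltin).
      exists (p i.+1); last exact: joined_refl.
      by have := ep i ltin; move: sp; rewrite /seg /adj4 /near /=; lia.
    by exists v => //; apply: joined_step jv _ _ => //; exact: ep.
  have fn : finite_set near by apply: finite_setX; exact: finite_II.
  by rewrite finite_setU; split=> //; apply: bigcup_finite.
have ex : exists x, C (x, 0) by exists 0.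
have ub x : C (x, 0) -> x <= N by move=> /boundC[/=]; lia.
case: (ex_maxnP ex ub) => r1 Cr1 max1.
have Rr : R0 < r1.+1 by rewrite ltnS; apply: max1; apply: Cseg.
have nCr x : r1.+1 <= x -> ~~ C (x, 0).
  by move=> rx; apply/negP => /max1; lia.
have [v [n [p [wp p0 pn]]] v0] :=
  @boundary_reaches_axis C N boundC C0 connC r1.+1 isT Cr1 nCr.
have [|m [q [wq q0 Tq nT ne]]] := @chordless_walk _ _ (fun u => u.1 == 0) _ _ wp.
  by rewrite pn v0.
exists r1.+1; split=> //.
apply: (@chordless_axis_walk _ q _ m); rewrite ?q0 //; last exact/eqP.
(* A good site of the boundary would have been absorbed into [C]. *)
case: wq => eq Bq; split=> // i im; move: (Bq i im) => /andP[nC /asboolP[u Cu uq]].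
by apply/negP => gq; move: nC; rewrite (Cstep u) // /good' gq.
Qed.

End lattice.

(** * Tiles and nearest-neighbour edges *)

(* Site [v] stands for the tile [shift2 v], so that its block consists of the
   tiles [v + (i, j)] with [i, j < 5] and stays in the quadrant. *)
Definition shift2 (v : site) : site := (v.1 + 2, v.2 + 2)%N.

Definition block_count (N : site * bool -> nat) (v : site) : nat :=
  (\sum_(j : 'I_5 * 'I_5 * bool) N ((v.1 + j.1.1, v.2 + j.1.2)%N, j.2))%N.

Definition good_site (N : site * bool -> nat) : pred site :=
  fun v => (0 < N (shift2 v, true))%N && (block_count N v <= 188)%N.

Section tiles.
Variables (R : realType) (a : R).
Hypothesis a_gt0 : 0 < a.

Definition tile_side (i : nat) : set R := `[a * i%:R, a * (i%:R + 1)[.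

(* [187 / 100] and [87 / 100] bound the coordinate differences of core points of
   adjacent tiles, [413 / 200 = 2 + 13 / 200] is the distance from a core to the
   outside of its block, and [1.87 ^ 2 + 0.87 ^ 2 < 2.065 ^ 2]. *)
Definition core_side (i : nat) : set R :=
  `[a * (i%:R + 13 / 200), a * (i%:R + 187 / 200)[.

Definition tile (c : site) : set (pt R) := tile_side c.1 `*` tile_side c.2.

Definition core (c : site) : set (pt R) := core_side c.1 `*` core_side c.2.

(** Splitting tiles into core and rest yields disjoint sets, so that core occupation and block
    counts are read off independent counts. *)
Definition region (i : site * bool) : set (pt R) :=
  if i.2 then core i.1 else tile i.1 `\` core i.1.

Lemma tile_side_inj i j x : tile_side i x -> tile_side j x -> i = j.
Proof.
rewrite /tile_side /= !in_itv /= => /andP[i1 i2] /andP[j1 j2].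
have lt m n : a * m%:R <= x -> x < a * (n%:R + 1) -> (m <= n)%N.
  move=> mx xn; have := le_lt_trans mx xn.
  by rewrite (ltr_pM2l a_gt0) natr1 ltr_nat ltnS.
by apply/eqP; rewrite eqn_leq (lt i j) // (lt j i).
Qed.

Lemma tile_inj c c' x : tile c x -> tile c' x -> c = c'.
Proof.
case: c c' => [i j] [i' j'] [/= x1 x2] [/= y1 y2].
by rewrite (tile_side_inj _ _ _ x1 y1) (tile_side_inj _ _ _ x2 y2).
Qed.

Lemma core_side_sub i : core_side i `<=` tile_side i.
Proof.
move=> x; rewrite /tile_side /core_side /= !in_itv /= => /andP[x1 x2].
apply/andP; split; [apply: le_trans x1|apply: lt_le_trans x2 _];
  by rewrite (ler_pM2l a_gt0); lra.
Qed.

Lemma core_sub c : core c `<=` tile c.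
Proof. by move=> x [x1 x2]; split; exact: core_side_sub. Qed.

Lemma region_sub i : region i `<=` tile i.1.
Proof. by rewrite /region; case: i.2 => [|x []//]; exact: core_sub. Qed.

Lemma region_disjoint i j : i != j -> region i `&` region j = set0.
Proof.
move=> ij; rewrite -subset0 => x [xi xj].
have e1 := tile_inj _ _ _ (region_sub i x xi) (region_sub j x xj).
case: i j e1 ij xi xj => [c b] [c' b'] /= <-; rewrite xpair_eqE eqxx /=.
by rewrite /region /=; case: b b' => [] [] //= _; [move=> cx []|case].
Qed.

Lemma tile_region c x : tile c x -> exists b, region (c, b) x.
Proof.
by move=> tx; have [cx|cx] := pselect (core c x); [exists true|exists false].
Qed.

Lemma near_side (i : nat) (x z : R) : core_side (i + 2) x ->
  `|x - z| < a * (413 / 200) -> exists u : 'I_5, tile_side (i + u) z.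
Proof.
rewrite /core_side /tile_side /= in_itv /= ltr_norml !natrD => /andP[x1 x2] /andP[z1 z2].
set t := a * i%:R.
have {}x1 : t + a * (413 / 200) <= x.
  by rewrite /t; lra.
(* [587 / 200 = 2 + 187 / 200]; adding [413 / 200] gives 5, so [z] lies between [t] and
   [t + a * 5]. *)
have {}x2 : x < t + a * (587 / 200).
  by rewrite /t; lra.
have mem (n : nat) : (n < 5)%N -> t + a * n%:R <= z < t + a * (n%:R + 1) ->
    exists u : 'I_5, [set` `[(a * (i + u)%:R), (a * ((i + u)%:R + 1))[] z.
  move=> n5 zn; exists (Ordinal n5); rewrite /= in_itv /= natrD.
  by rewrite -addrA !mulrDr -/t -mulrDr.
have [h1|h1] := ltP z (t + a); first by apply: (mem 0%N) => //; lra.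
have [h2|h2] := ltP z (t + a * 2); first by apply: (mem 1%N) => //; lra.
have [h3|h3] := ltP z (t + a * 3); first by apply: (mem 2%N) => //; lra.
have [h4|h4] := ltP z (t + a * 4); first by apply: (mem 3%N) => //; lra.
by apply: (mem 4%N) => //; lra.
Qed.

Lemma core_side_dist i (x y : R) : core_side i x -> core_side i y ->
  (x - y) ^+ 2 <= (a * (87 / 100)) ^+ 2.
Proof.
rewrite /core_side /= !in_itv /= => /andP[x1 x2] /andP[y1 y2].
rewrite -real_normK ?num_real // ler_pXn2r ?nnegrE ?mulr_ge0 ?ler_norml //; lra.
Qed.

Lemma core_side_distS i (x y : R) : core_side i x -> core_side i.+1 y ->
  (x - y) ^+ 2 <= (a * (187 / 100)) ^+ 2.
Proof.
rewrite /core_side /= !in_itv /= -natr1 => /andP[x1 x2] /andP[y1 y2].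
rewrite -real_normK ?num_real // ler_pXn2r ?nnegrE ?mulr_ge0 ?ler_norml //; lra.
Qed.

Lemma core_dist v v' (x y : pt R) : adj4 v v' ->
  core (shift2 v) x -> core (shift2 v') y ->
  (x.1 - y.1) ^+ 2 + (x.2 - y.2) ^+ 2 < (a * (413 / 200)) ^+ 2.
Proof.
case: v v' => [i j] [i' j']; rewrite /adj4 /core /shift2 /=.
have key (p q : R) : p <= (a * (87 / 100)) ^+ 2 -> q <= (a * (187 / 100)) ^+ 2 ->
    p + q < (a * (413 / 200)) ^+ 2.
  have : 0 < a ^+ 2 by rewrite exprn_gt0.
  rewrite !exprMn; lra.
move=> /orP[] /andP[/eqP ?] /orP[] /eqP ?; subst => -[x1 x2] [y1 y2].
- apply: key; first exact: core_side_dist x1 y1.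
  by rewrite -sqrrN opprB; exact: core_side_distS y2 x2.
- by apply: key; [exact: core_side_dist x1 y1|exact: core_side_distS x2 y2].
- rewrite addrC; apply: key; first exact: core_side_dist x2 y2.
  by rewrite -sqrrN opprB; exact: core_side_distS y1 x1.
- by rewrite addrC; apply: key; [exact: core_side_dist x2 y2|exact: core_side_distS x1 y1].
Qed.

Lemma sqr_lt_norm (s t : R) : 0 <= t -> s ^+ 2 < t ^+ 2 -> `|s| < t.
Proof.
by move=> t0; rewrite -(real_normK (num_real s)) ltr_pXn2r ?nnegrE.
Qed.

(** [core_dist] bounds the distance from [x] to [y], hence to [z], hence each coordinate of
    [x - z]. *)
Lemma near_block v v' (x y z : pt R) : adj4 v v' ->
  core (shift2 v) x -> core (shift2 v') y -> Defs.edist x z < Defs.edist x y ->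
  exists j : 'I_5 * 'I_5, tile (v.1 + j.1, v.2 + j.2)%N z.
Proof.
have X0 : 0 <= a * (413 / 200) by rewrite mulr_ge0 ?divr_ge0 ?ler0n ?(ltW a_gt0).
move=> vv' cx cy; have := core_dist _ _ _ _ vv' cx cy.
rewrite /Defs.edist; set Dy := (X in X < _); set Dz := (X in Num.sqrt X < _) => dy dzy.
have Dy0 : 0 <= Dy by rewrite addr_ge0 ?sqr_ge0.
have Dz0 : 0 <= Dz by rewrite addr_ge0 ?sqr_ge0.
have dz : Dz < (a * (413 / 200)) ^+ 2.
  apply: lt_trans dy; rewrite ltNge; apply/negP => /ler_wsqrtr; rewrite leNgt.
  by move=> /negP; exact.
have near (s : R) : s ^+ 2 <= Dz -> `|s| < a * (413 / 200).
  by move=> sD; exact: sqr_lt_norm X0 (le_lt_trans sD dz).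
have [/= u hu] : exists u : 'I_5, tile_side (v.1 + u) z.1.
  by apply: (near_side _ x.1); [case: cx|apply: near; rewrite lerDl sqr_ge0].
have [/= w hw] : exists u : 'I_5, tile_side (v.2 + u) z.2.
  by apply: (near_side _ x.2); [case: cx|apply: near; rewrite lerDr sqr_ge0].
by exists (u, w).
Qed.

(** * From good tiles to clusters of the neighbour graph *)

Section configuration.
Variables (S : set (pt R)) (N : site * bool -> nat) (k : nat).
Hypothesis N_card : forall i, has_card (S `&` region i) (N i).
Hypothesis k_gt : (188 < k)%N.

Lemma good_edge v v' x y : adj4 v v' -> good_site N v ->
  S x -> S y -> core (shift2 v) x -> core (shift2 v') y -> nn_edge S k x y.
Proof.
move=> vv' /andP[_ Nv] Sx Sy cx cy; split=> //; split=> //; left.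
split=> //; split.
  move=> yx; subst y; have := tile_inj _ _ _ (core_sub _ _ cx) (core_sub _ _ cy).
  by case: v v' vv' {Nv cx cy} => [i j] [i' j']; rewrite /adj4 /shift2 /= => ? []; lia.
have [s sP] := choice N_card.
exists (flatten [seq s ((v.1 + j.1.1, v.2 + j.1.2)%N, j.2) |
  j : 'I_5 * 'I_5 * bool <- index_enum ('I_5 * 'I_5 * bool)%type]); split.
  apply: leq_ltn_trans k_gt; apply: leq_trans Nv.
  rewrite size_flatten /shape sumnE !big_map /block_count.
  by apply: leq_sum => j _; have [_ ->] := sP ((v.1 + j.1.1, v.2 + j.1.2)%N, j.2).
move=> z /= [Sz [_ xz]].
have [j jz] := near_block _ _ _ _ _ vv' cx cy xz.
have [b bz] := tile_region _ _ jz.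
apply/flattenP; exists (s ((v.1 + j.1, v.2 + j.2)%N, b)).
  by apply/mapP; exists (j, b) => //; rewrite mem_index_enum.
have [_ _ E] := sP ((v.1 + j.1, v.2 + j.2)%N, b).
by have : (S `&` region ((v.1 + j.1, v.2 + j.2)%N, b)) z by []; rewrite E.
Qed.

(** One core point is chosen per good tile; [back] recovers the tile, so infinitely many tiles give
    infinitely many points. *)
Lemma infinite_good_cluster v :
  infinite_set [set u | joined adj4 (good_site N) v u] -> has_infinite_cluster S k.
Proof.
move=> inf.
have gP u : good_site N u -> exists x, S x /\ core (shift2 u) x.
  move=> /andP[N0 _]; have [[|x s] [_ sz E]] := N_card (shift2 u, true).
    by rewrite -sz in N0.
  have : [set z | z \in x :: s] x by rewrite /= inE eqxx.
  by rewrite -E => -[Sx cx]; exists x.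
have gP' (u : site) : exists x : pt R, good_site N u -> S x /\ core (shift2 u) x.
  have [gu|ngu] := boolP (good_site N u); last by exists (0, 0).
  by have [x xP] := gP u gu; exists x.
have [X XP] := choice gP'.
have gv : good_site N v.
  apply: contrapT => ngv; apply: inf; apply: sub_finite_set (finite_set0 _).
  by move=> u /= [n [p [[_ gp] p0 _]]]; apply: ngv; rewrite -p0; exact: gp.
have sv := XP v gv.
exists (X v); split; first by case: sv.
pose back (x : pt R) : site := xget (0, 0)%N [set u | core (shift2 u) x].
have backK u : good_site N u -> back (X u) = u.
  move=> gu; have [_ cu] := XP u gu.
  rewrite /back; case: xgetP => [w _ cw|/(_ u)//].
  have [] := tile_inj _ _ _ (core_sub _ _ cw) (core_sub _ _ cu).
  by case: w u {cw cu gu} => [? ?] [? ?] /= ? ?; congr pair; lia.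
move=> fin; apply: inf.
apply: (@sub_finite_set _ _ (back @` [set y | clos_refl_trans _ (nn_edge S k) (X v) y]));
  last exact: finite_image.
move=> u ju; exists (X u); last by apply: backK; exact: joined_tgt ju.
case: ju => [n [p [[ep gp] p0 <-]]] /=; rewrite -p0.
suff: forall i, (i <= n)%N ->
    clos_refl_trans (pt R) (nn_edge S k) (X (p 0%N)) (X (p i)) by apply.
elim=> [_|i IH ltin]; first exact: rt_refl.
apply: rt_trans (IH (ltnW ltin)) _; apply: rt_step.
have [Si ci] := XP _ (gp i (ltnW ltin)); have [Sj cj] := XP _ (gp _ ltin).
by apply: (good_edge (p i) (p i.+1)) => //; [exact: ep|exact/gp/ltnW].
Qed.

End configuration.
End tiles.

Arguments tile_side {R}.
Arguments core_side {R}.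
Arguments tile {R}.
Arguments core {R}.
Arguments region {R}.

(** * Exponential weights of Poisson counts *)

Section weights.
Variable R : realType.

Lemma exp_partial_sum_le (x : R) n : 0 <= x ->
  \sum_(i < n) x ^+ i / i`!%:R <= expR x.
Proof.
move=> x0; rewrite -(big_mkord xpredT (fun i => x ^+ i / i`!%:R)).
apply: (nondecreasing_cvgn_le _ (is_cvg_series_exp_coeff x)) => m p mp.
rewrite /series /= [leRHS](big_cat_nat _ (n := m)) //= lerDl sumr_ge0 // => i _.
exact: exp_coeff_ge0.
Qed.

Lemma pois_ge0 (mu : R) n : 0 <= mu -> 0 <= pois mu n.
Proof. by move=> m0; rewrite /pois mulr_ge0 ?expR_ge0 // divr_ge0 ?exprn_ge0. Qed.

(** Partial sums of the Poisson generating function suffice, as counts are truncated below to keep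
    configurations finite. *)
Lemma pois_mgf_le (mu y : R) n : 0 <= mu -> 0 <= y ->
  \sum_(i < n) pois mu i * y ^+ i <= expR (mu * (y - 1)).
Proof.
move=> m0 y0; rewrite mulrBr mulr1 expRD.
apply: le_trans (ler_wpM2r (expR_ge0 _) (exp_partial_sum_le _ n (mulr_ge0 m0 y0))).
rewrite mulr_suml; apply: ler_sum => i _; rewrite /pois exprMn.
by rewrite le_eqVlt; apply/orP; left; apply/eqP; ring.
Qed.

(** Convexity. The bound is linear in [t], so that multiplicities can later be summed block by
    block. *)
Lemma expR_chord (t : R) : 0 <= t <= 1 -> expR t - 1 <= t * (expR 1 - 1).
Proof.
move=> t01; have [t0 t1] := andP t01.
have := convex_expR (Itv01 t0 t1) (1 : R^o) (0 : R^o).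
rewrite !convRE /= expR0 /unstable.onem mulr0 addr0 !mulr1; lra.
Qed.

(** Here [T] indexes regions with means [mu], [K] the tiles of a path, [blk k] the regions in the
    block of tile [k] and [z k] its core; [m] is a mean per tile. *)
Variables (T K : finType) (mu : T -> R) (blk : K -> {set T}) (z : K -> T).
Variables (m nu : R) (M : nat).
Hypothesis mu_ge0 : forall i, 0 <= mu i.
Hypothesis z_inj : injective z.
Hypothesis mu_z : forall k, mu (z k) = nu.
Hypothesis blk_mult : forall i, (#|[pred k | i \in blk k]| <= 25)%N.
Hypothesis blk_mass : forall k, \sum_(i in blk k) mu i <= 25 * m.

Let q := expR (- nu).
Let c := expR (m * (expR 1 - 1) - 189 / 25).
Let occ (f : {ffun T -> 'I_M}) (k : K) : R := (\sum_(i in blk k) (f i : nat))%N%:R.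
Let mult (J : {set K}) (i : T) : nat := #|[pred k | (k \notin J) && (i \in blk k)]|.
(** Factor borne by region [i] when the tiles in [J] are charged with an empty core and the others
    with an overcrowded block. *)
Let h (J : {set K}) (i : T) (x : nat) : R :=
  (if i \in z @: J then (x == 0%N)%:R else 1) * expR ((mult J i)%:R / 25) ^+ x.

Lemma sum_mult (J : {set K}) (F : T -> R) :
  \sum_i (mult J i)%:R * F i = \sum_(k | k \notin J) \sum_(i in blk k) F i.
Proof.
rewrite (exchange_big_dep xpredT) //=; apply: eq_bigr => i _.
rewrite mulr_natl -sumr_const; apply: eq_bigl => k.
by rewrite inE.
Qed.

Lemma subset_weight_le (J : {set K}) (f : {ffun T -> 'I_M}) :
  \prod_k (if k \in J then (f (z k) == 0%N :> nat)%:R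
            else expR ((occ f k - 189) / 25)) <=
  (\prod_i h J i (f i)) * \prod_(k | k \notin J) expR (- (189 / 25)).
Proof.
rewrite (bigID (mem J)) /=.
have -> : \prod_i h J i (f i) =
    (\prod_i (if i \in z @: J then (f i == 0%N :> nat)%:R else 1)) *
    \prod_(k | k \notin J) expR (occ f k / 25).
  rewrite big_split /=; congr (_ * _).
  rewrite -expR_sum; under eq_bigr do rewrite -expRM_natr.
  rewrite -expR_sum; congr expR.
  under eq_bigr do rewrite -mulrA.
  rewrite sum_mult; apply: eq_bigr => k _.
  rewrite /occ natr_sum mulr_suml; apply: eq_bigr => i _; exact: mulrC.
rewrite -mulrA -big_split /=; apply: ler_pM.
- by apply: prodr_ge0 => k _; case: ifP => _; rewrite ?ler0n ?expR_ge0.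
- by apply: prodr_ge0 => k _; case: ifP => _; rewrite ?ler0n ?expR_ge0.
- have [e0|] := boolP [forall (k | k \in J), f (z k) == 0%N :> nat]; last first.
    rewrite negb_forall => /existsP[k]; rewrite negb_imply => /andP[kJ /negbTE nz].
    rewrite (bigD1 k) //= kJ nz mul0r.
    by apply: prodr_ge0 => i _; case: ifP; rewrite ?ler0n ?ler01.
  rewrite [leRHS]big1 ?big1 // => [k kJ|i _].
    by rewrite kJ (forall_inP e0).
  by case: ifP => // /imsetP[k kJ ->]; rewrite (forall_inP e0).
- rewrite le_eqVlt; apply/orP; left; apply/eqP; apply: eq_bigr => k /negbTE ->.
  by rewrite -expRD; congr expR; rewrite mulrBl.
Qed.

(** On a core that must be empty only count 0 survives, with probability [q]. Elsewhere the
    generating function is taken at the exponential of a multiplicity over 25, and [expR_chord]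
    applies because multiplicities are at most 25. *)
Lemma site_sum_le (J : {set K}) i :
  \sum_(x < M) pois (mu i) x * h J i x <=
  (if i \in z @: J then q else 1) *
    expR ((mult J i)%:R * (mu i / 25 * (expR 1 - 1))).
Proof.
have e1 : 0 <= (mult J i)%:R * (mu i / 25 * (expR 1 - 1)) :> R.
  by rewrite !mulr_ge0 ?divr_ge0 // subr_ge0 -[leLHS]expR0 ler_expR.
rewrite /h; case: imsetP => [[k _ ik]|_].
  have -> : q = pois (mu i) 0 by rewrite /q /pois ik mu_z expr0 divr1 mul1r.
  apply: (@le_trans _ _ (pois (mu i) 0)); last first.
    by rewrite ler_peMr ?pois_ge0 // -[leLHS]expR0 ler_expR.
  case: M => [|n]; first by rewrite big_ord0 pois_ge0.
  rewrite big_ord_recl /= expr0 !mulr1 gerDl.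
  by rewrite sumr_le0 // => x _; rewrite /= mul0r mulr0.
rewrite mul1r; under eq_bigr do rewrite mul1r.
apply: le_trans (pois_mgf_le _ _ _ (mu_ge0 i) (expR_ge0 _)) _.
rewrite ler_expR mulrCA -mulrA ler_wpM2l // mulrCA mulrA; apply: expR_chord.
rewrite divr_ge0 //= ler_pdivrMr // mul1r ler_nat.
apply: leq_trans (blk_mult i); apply: subset_leq_card.
by apply/fintype.subsetP => k; rewrite !inE => /andP[].
Qed.

(** Expanding the product over subsets [J] of tiles leaves sums that factor over regions; after
    [site_sum_le] the exponents of each block collect to at most that of [c], and summing over [J]
    refolds into a power. *)
Lemma config_weight_le :
  \sum_(f : {ffun T -> 'I_M}) (\prod_i pois (mu i) (f i)) *
    \prod_k ((f (z k) == 0%N :> nat)%:R + expR ((occ f k - 189) / 25)) <=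
  (q + c) ^+ #|K|.
Proof.
rewrite -[leRHS]prodr_const [leRHS]bigA_distr /=.
under eq_bigr do rewrite bigA_distr mulr_sumr.
rewrite exchange_big /=; apply: ler_sum => J _.
apply: (@le_trans _ _ (\sum_(f : {ffun T -> 'I_M})
    (\prod_i (pois (mu i) (f i) * h J i (f i))) *
    \prod_(k | k \notin J) expR (- (189 / 25)))).
  apply: ler_sum => f _; rewrite [X in _ <= X * _]big_split /= -[leRHS]mulrA.
  rewrite ler_wpM2l ?subset_weight_le //.
  by apply: prodr_ge0 => i _; exact: pois_ge0.
rewrite -mulr_suml -(bigA_distr_bigA (fun i (x : 'I_M) => pois (mu i) x * h J i x)).
apply: (@le_trans _ _ ((\prod_i ((if i \in z @: J then q else 1) *
    expR ((mult J i)%:R * (mu i / 25 * (expR 1 - 1))))) *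
    \prod_(k | k \notin J) expR (- (189 / 25)))).
  apply: ler_wpM2r; first by apply: prodr_ge0 => k _; exact: expR_ge0.
  apply: ler_prod => i _; rewrite site_sum_le andbT sumr_ge0 // => x _.
  rewrite mulr_ge0 ?pois_ge0 // /h mulr_ge0 ?exprn_ge0 ?expR_ge0 //.
  by case: ifP.
rewrite [leRHS](bigID (mem J)) /= big_split /= -mulrA.
have -> : \prod_i (if i \in z @: J then q else 1) =
    \prod_(k in J) (if k \in J then q else c).
  rewrite -big_mkcond big_imset /=; last by move=> ? ? _ _; exact: z_inj.
  by apply: eq_bigr => k ->.
rewrite ler_wpM2l //.
  by apply: prodr_ge0 => k _; case: ifP => _; exact: expR_ge0.
rewrite -!expR_sum sum_mult -expRD -big_split /=.
rewrite [leRHS](eq_bigr (fun=> c)); last by move=> k /negbTE ->.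
rewrite -expR_sum ler_expR; apply: ler_sum => k _.
rewrite -mulr_suml -mulr_suml lerD2r ler_wpM2r //.
  by rewrite ler_pdivrMr // mulrC.
Qed.

End weights.

(** * Numerical bounds on the exponential *)

Section numerics.
Variable R : realType.

Lemma expR_double_ge (x b c : R) : 0 <= b -> b <= expR x -> c <= b * b ->
  c <= expR (x + x).
Proof. by move=> b0 bx cb; rewrite expRD (le_trans cb) // ler_pM. Qed.

(* [(1 + x / 128) ^+ 128 <= expR x], with rounding allowed after each squaring. *)
Lemma expR_ge_of_squares (x b1 b2 b3 b4 b5 b6 b7 : R) :
  let b0 := 1 + x / 128 in
  [/\ 0 <= b0, 0 <= b1, 0 <= b2 & 0 <= b3] -> [/\ 0 <= b4, 0 <= b5 & 0 <= b6] ->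
  [/\ b1 <= b0 * b0, b2 <= b1 * b1, b3 <= b2 * b2 & b4 <= b3 * b3] ->
  [/\ b5 <= b4 * b4, b6 <= b5 * b5 & b7 <= b6 * b6] -> b7 <= expR x.
Proof.
move=> b0 [p0 p1 p2 p3] [p4 p5 p6] [h1 h2 h3 h4] [h5 h6 h7].
have e1 := expR_double_ge _ _ _ p0 (expR_ge1Dx (x / 128)) h1.
have e2 := expR_double_ge _ _ _ p1 e1 h2.
have e3 := expR_double_ge _ _ _ p2 e2 h3.
have e4 := expR_double_ge _ _ _ p3 e3 h4.
have e5 := expR_double_ge _ _ _ p4 e4 h5.
have e6 := expR_double_ge _ _ _ p5 e5 h6.
have e7 := expR_double_ge _ _ _ p6 e6 h7.
by apply: le_trans e7 _; rewrite ler_expR; lra.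
Qed.

(** Squaring yields lower bounds only, so [expR (- 1)] is bounded below and inverted. *)
Lemma expR1_ub : expR 1 <= 2748 / 1000 :> R.
Proof.
have : 364 / 1000 <= expR (- 1) :> R.
  by apply: (@expR_ge_of_squares _ (9844 / 10000) (9690 / 10000) (9389 / 10000)
    (8815 / 10000) (7770 / 10000) (6037 / 10000)); split; lra.
have := expR_gt0 (1 : R); have : expR 1 * expR (- 1) = 1 :> R.
  by rewrite -expRD subrr expR0.
nra.
Qed.

Lemma bad_weight_lt : 5 * (expR (- (11 / 4 * (87 / 100) ^+ 2)) +
  expR (11 / 4 * (expR 1 - 1) - 189 / 25)) < 1 :> R.
Proof.
have inv_le (x y : R) : 0 < y -> y <= expR x -> expR (- x) <= y^-1.
  by move=> y0 yx; rewrite expRN lef_pV2 // posrE expR_gt0.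
have q : expR (- (11 / 4 * (87 / 100) ^+ 2)) <= (77 / 10)^-1 :> R.
  apply: (@le_trans _ _ (expR (- (208 / 100)))); first by rewrite ler_expR; lra.
  apply: inv_le; first lra.
  by apply: (@expR_ge_of_squares _ (10327 / 10000) (10664 / 10000) (1137 / 1000)
    (1292 / 1000) (1669 / 1000) (2785 / 1000)); split; lra.
have c : expR (11 / 4 * (expR 1 - 1) - 189 / 25) <= (150 / 10)^-1 :> R.
  (* With [expR 1 <= 2.748] the exponent is at most [4.807 - 7.56 = -2.753]. *)
  apply: (@le_trans _ _ (expR (- (275 / 100)))).
    by rewrite ler_expR; have := expR1_ub; lra.
  apply: inv_le; first lra.
  by apply: (@expR_ge_of_squares _ (10434 / 10000) (10886 / 10000) (1185 / 1000)
    (1404 / 1000) (1971 / 1000) (3884 / 1000)); split; lra.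
by apply: le_lt_trans (_ : 5 * ((77 / 10)^-1 + (150 / 10)^-1) < 1); lra.
Qed.

End numerics.

(** * Counts in the tiles *)

Section region_measure.
Variables (R : realType) (a : R).
Hypothesis a_gt0 : 0 < a.

Lemma leb2X (A B : set R) : measurable A -> measurable B ->
  leb2 (A `*` B) = (lebesgue_measure A * lebesgue_measure B)%E.
Proof. by move=> mA mB; rewrite /leb2 product_measure1E. Qed.

Lemma lebesgue_measure_co (x y : R) : x <= y ->
  lebesgue_measure (`[x, y[%classic : set R) = (y - x)%:E.
Proof.
rewrite le_eqVlt => /orP[/eqP ->|xy]; last by rewrite lebesgue_measure_itv /= lte_fin xy.
by rewrite lebesgue_measure_itv /= ltxx subrr.
Qed.

Lemma leb2_tile c : leb2 (tile a c) = (a ^+ 2)%:E.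
Proof.
have side i : lebesgue_measure (tile_side a i) = a%:E.
  by rewrite lebesgue_measure_co ?ler_pM2l //; [congr EFin; ring|lra].
by rewrite leb2X ?side //; exact: measurable_itv.
Qed.

Lemma leb2_core c : leb2 (core a c) = ((a * (87 / 100)) ^+ 2)%:E.
Proof.
have side i : lebesgue_measure (core_side a i) = (a * (87 / 100))%:E.
  by rewrite lebesgue_measure_co ?ler_pM2l //; [congr EFin; field|lra].
by rewrite leb2X ?side //; exact: measurable_itv.
Qed.

Lemma measurable_tile c : measurable (tile a c).
Proof. by apply: measurableX; exact: measurable_itv. Qed.

Lemma measurable_core c : measurable (core a c).
Proof. by apply: measurableX; exact: measurable_itv. Qed.

Lemma measurable_region i : measurable (region a i).
Proof.
by rewrite /region; case: i.2; [|apply: measurableD];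
  [exact: measurable_core|exact: measurable_tile|exact: measurable_core].
Qed.

Lemma bounded2_region i : bounded2 (region a i).
Proof.
exists (a * (i.1.1%:R + i.1.2%:R + 1)) => x xi.
have := region_sub _ _ a_gt0 i x xi; rewrite /tile /tile_side /= !in_itv /= => -[/andP[x1 x2] /andP[y1 y2]].
have n1 : 0 <= a * i.1.1%:R by rewrite mulr_ge0 // ltW.
have n2 : 0 <= a * i.1.2%:R by rewrite mulr_ge0 // ltW.
by rewrite !ger0_norm; lra.
Qed.

(** [11 / 4] is the mean of a whole tile and [(87 / 100) ^+ 2] the share of its core. *)
Definition region_mean (b : bool) : R :=
  if b then 11 / 4 * (87 / 100) ^+ 2 else 11 / 4 * (1 - (87 / 100) ^+ 2).

Lemma region_mean_ge0 b : 0 <= region_mean b.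
Proof. by rewrite /region_mean; case: b; lra. Qed.

Lemma leb2_region lam i : lam * a ^+ 2 = 11 / 4 ->
  lam * fine (leb2 (region a i)) = region_mean i.2.
Proof.
move=> la; rewrite /region /region_mean; case: i => c [] /=.
  by rewrite leb2_core // /= exprMn mulrA la.
have -> : leb2 (tile a c `\` core a c) =
    (leb2 (tile a c) - leb2 (tile a c `&` core a c))%E.
  apply: measureD; [exact: measurable_tile|exact: measurable_core|].
  by rewrite [X in (X < _)%E](_ : _ = (a ^+ 2)%:E) ?ltry //; exact: leb2_tile.
rewrite (setIidr (core_sub _ _ a_gt0 c)) leb2_tile leb2_core -EFinB /=.
by rewrite exprMn -la; ring.
Qed.

End region_measure.

Lemma has_card_uniq (R : realType) (A : set (pt R)) m n :
  has_card A m -> has_card A n -> m = n.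
Proof.
move=> [s [us <- ->]] [t [ut <-]] /seteqP[st ts].
by apply: perm_size; apply: uniq_perm => // x; apply/idP/idP; [exact: st|exact: ts].
Qed.

Lemma measure_bigsetU_le (d : measure_display) (T : measurableType d)
    (R : realType) (mu : {measure set T -> \bar R}) (I : Type) (s : seq I)
    (Q : pred I) (F : I -> set T) :
  (forall i, Q i -> measurable (F i)) ->
  (mu (\big[setU/set0]_(i <- s | Q i) F i) <= \sum_(i <- s | Q i) mu (F i))%E.
Proof.
move=> mF; elim: s => [|i s IH]; first by rewrite !big_nil measure0.
rewrite !big_cons; case: ifP => // Qi.
apply: le_trans (measureU2 _ (mF i Qi) _) _; last exact: leeD2l.
exact: bigsetU_measurable.
Qed.

Arguments region_mean {R}.

(** * Law and independence of the region counts *)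

Section poisson_counts.
Variables (R : realType) (d : measure_display) (Omega : measurableType d).
Variables (P : probability Omega R) (lam : R) (S : Omega -> set (pt R)) (a : R).
Hypothesis a_gt0 : 0 < a.
Hypothesis lam_a : lam * a ^+ 2 = 11 / 4.
Hypothesis ppS : poisson_pp P lam S.

Lemma measurable_count i n : measurable (count_event S (region a i) n).
Proof.
by case: (ppS.1 (region a i) n (measurable_region _ a i) (bounded2_region _ _ a_gt0 i)).
Qed.

Lemma prob_count i n :
  P (count_event S (region a i) n) = (pois (region_mean i.2) n)%:E.
Proof.
have [_ ->] := ppS.1 (region a i) n (measurable_region _ a i) (bounded2_region _ _ a_gt0 i).
by rewrite (leb2_region _ _ a_gt0).
Qed.

Definition counts_event (T : finType) (reg : T -> site * bool) (n : T -> nat) :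
  set Omega := [set w | forall i, count_event S (region a (reg i)) (n i) w].

Lemma measurable_counts (T : finType) (reg : T -> site * bool) n :
  measurable (counts_event T reg n).
Proof.
have -> : counts_event T reg n =
    \bigcap_(i in [set: T]) count_event S (region a (reg i)) (n i).
  by apply/seteqP; split=> w h i //; exact: h.
by apply: fin_bigcap_measurable => // i _; exact: measurable_count.
Qed.

(** Independence, assumed for families indexed by ordinals, is carried to [T] by [enum_val];
    injectivity of [reg] makes the regions disjoint. *)
Lemma prob_counts (T : finType) (reg : T -> site * bool) n : injective reg ->
  P (counts_event T reg n) = (\prod_i pois (region_mean (reg i).2) (n i))%:E.
Proof.
move=> reg_inj.
rewrite -[LHS]fineK; last by rewrite fin_num_measure //; exact: measurable_counts.
congr EFin.
have := ppS.2 #|T| (fun j => region a (reg (enum_val j))) (fun j => n (enum_val j)).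
have -> : [set w | forall j : 'I_#|T|, count_event S
    (region a (reg (enum_val j))) (n (enum_val j)) w] = counts_event T reg n.
  apply/seteqP; split=> w h i; last exact: h.
  by have := h (enum_rank i); rewrite enum_rankK.
move=> ->.
- rewrite (reindex (fun j : 'I_#|T| => enum_val j)) /=; last first.
    by apply: onW_bij; exact: enum_val_bij.
  by apply: eq_bigr => j _; rewrite prob_count.
- by move=> j; exact: measurable_region.
- by move=> j; exact: bounded2_region.
- move=> i j ij; apply: region_disjoint => //; apply: contra ij => /eqP.
  by move=> /reg_inj/enum_val_inj ->.
Qed.

(** Poisson masses add up to 1, so each region almost surely holds finitely many points, and there
    are countably many regions. *)
Lemma ae_has_card : {ae P, forall w, exists N : site * bool -> nat,
  forall i, has_card (S w `&` region a i) (N i)}.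
Proof.
pose E i := \bigcup_n count_event S (region a i) n.
have mE i : measurable (E i).
  by apply: bigcupT_measurable => n; exact: measurable_count.
have PE i : P (E i) = 1%E.
  rewrite measure_bigcup //; last 2 first.
  - by move=> n _; exact: measurable_count.
  - move=> m n _ _ [w [wm wn]]; exact: has_card_uniq wm wn.
  pose mu : R := region_mean i.2.
  rewrite (eq_eseriesl (Q := xpredT)); last by move=> n; rewrite in_setT.
  rewrite (eq_eseriesr (g := fun n => (pois mu n)%:E)); last first.
    by move=> n _; exact: prob_count.
  apply: cvg_lim => //.
  rewrite (_ : (fun n => _) = EFin \o (fun n => expR (- mu) * series (exp_coeff mu) n)).
    rewrite -[X in _ --> X](_ : (expR (- mu) * expR mu)%:E = 1%E); last first.
      by rewrite -expRD addrC subrr expR0.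
    apply: cvg_EFin; first by near=> n.
    by apply: cvgMr; exact: is_cvg_series_exp_coeff.
  apply/funext => n; rewrite sumEFin /= mulr_sumr; congr EFin.
  by apply: eq_bigr => k _; rewrite /pois mulrC.
have nE i : P.-negligible (~` E i).
  apply/negligibleP; first exact: measurableC.
  by transitivity (1 - P (E i))%E; [exact: probability_setC|rewrite PE subee].
pose F k := if unpickle k is Some i then ~` E i else set0.
apply: (@negligibleS _ _ _ P (\bigcup_k F k)); last first.
  apply: negligible_bigcup => k; rewrite /F; case: unpickle => [i|]; first exact: nE.
  exact: negligible_set0.
move=> w nN; apply: contrapT => nF; apply: nN.
have all_card i : exists n, has_card (S w `&` region a i) n.
  apply: contrapT => nn; apply: nF; exists (pickle i) => //.
  by rewrite /F pickleK => -[n _ wn]; apply: nn; exists n.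
by have [N NP] := choice all_card; exists N.
Unshelve. all: by end_near. Qed.
End poisson_counts.

Arguments counts_event {R d Omega} S a {T}.

(** * Paths of bad tiles *)

Section bad_paths.
Variables (R : realType) (d : measure_display) (Omega : measurableType d).
Variables (P : probability Omega R) (lam : R) (S : Omega -> set (pt R)) (a : R).
Hypothesis a_gt0 : 0 < a.
Hypothesis lam_a : lam * a ^+ 2 = 11 / 4.
Hypothesis ppS : poisson_pp P lam S.

(** The sum [q + c] of [config_weight_le] for tiles of mean [11 / 4]. *)
Definition site_weight : R := expR (- (11 / 4 * (87 / 100) ^+ 2)) +
  expR (11 / 4 * (expR 1 - 1) - 189 / 25).

Section one_path.
Variables (g : seq site) (L : nat).
Hypothesis g_uniq : uniq g.
Hypothesis g_bound : forall v, v \in g -> (v.1 + 4 <= L)%N /\ (v.2 + 4 <= L)%N.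

Let T := ('I_L.+1 * 'I_L.+1 * bool)%type.
Let K := 'I_(size g).
Let reg (i : T) : site * bool := ((i.1.1 : nat, i.1.2 : nat), i.2).
Let v (k : K) : site := nth (0, 0)%N g k.
(** [g_bound] keeps the coordinates of whole blocks at most [L], so [inord] never falls back on its
    default. *)
Let place (k : K) (j : 'I_5 * 'I_5 * bool) : T :=
  (inord ((v k).1 + j.1.1), inord ((v k).2 + j.1.2), j.2).
Let blk (k : K) : {set T} := place k @: finset.setT.
Let z (k : K) : T := place k (inord 2, inord 2, true).

Let bad_counts (f : T -> nat) : bool :=
  [forall k, (f (z k) == 0) || (188 < \sum_(i in blk k) f i)]%N.

Let v_bound k : ((v k).1 + 4 <= L)%N /\ ((v k).2 + 4 <= L)%N.
Proof. by apply: g_bound; rewrite mem_nth. Qed.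

Let reg_inj : injective reg.
Proof.
by move=> [[i j] b] [[i' j'] b'] [/val_inj -> /val_inj -> ->].
Qed.

Let v_inj : injective v.
Proof.
by move=> k k' /eqP; rewrite /v nth_uniq // => /eqP/val_inj.
Qed.

Let reg_place k j : reg (place k j) = (((v k).1 + j.1.1, (v k).2 + j.1.2)%N, j.2).
Proof.
have [b1 b2] := v_bound k; have := ltn_ord j.1.1; have := ltn_ord j.1.2 => j1 j2.
by rewrite /reg /= !inordK //; lia.
Qed.

Let place_inj k : injective (place k).
Proof.
move=> [[i j] b] [[i' j'] b'] /(congr1 reg); rewrite !reg_place /= => -[].
by move=> /addnI/val_inj -> /addnI/val_inj -> ->.
Qed.

Let reg_z k : reg (z k) = (shift2 (v k), true).
Proof. by rewrite reg_place /shift2 /= !inordK. Qed.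

Let z_inj : injective z.
Proof.
move=> k k' /(congr1 reg); rewrite !reg_z => -[e1 e2]; apply: v_inj.
by move: e1 e2; case: (v k) (v k') => [? ?] [? ?] /= e1 e2; congr pair; lia.
Qed.

(** The offset of a given tile in a block determines the block, and there are 25 offsets. *)
Let blk_mult i : (#|[pred k | i \in blk k]| <= 25)%N.
Proof.
have -> : 25%N = #|{: 'I_5 * 'I_5}| by rewrite card_prod card_ord.
pose off (k : K) : 'I_5 * 'I_5 := (inord (i.1.1 - (v k).1), inord (i.1.2 - (v k).2)).
apply: (@leq_card_in _ _ off) => k k'; rewrite !inE => /imsetP[j _ ij] /imsetP[j' _ ij'].
move=> [/(congr1 val)/= e1 /(congr1 val)/= e2]; apply: v_inj.
have := congr1 reg ij; have := congr1 reg ij'; rewrite !reg_place /reg.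
move=> [r1' r2' _] [r1 r2 _]; move: e1 e2.
have := ltn_ord j.1.1; have := ltn_ord j.1.2; have := ltn_ord j'.1.1; have := ltn_ord j'.1.2.
move=> h1 h2 h3 h4.
have [s1 s2] : (i.1.1 - (v k).1 < 5)%N /\ (i.1.2 - (v k).2 < 5)%N by rewrite r1 r2 !addKn.
have [s1' s2'] : (i.1.1 - (v k').1 < 5)%N /\ (i.1.2 - (v k').2 < 5)%N by rewrite r1' r2' !addKn.
rewrite !inordK //.
clear s1 s2 s1' s2'; case: (v k) (v k') r1 r2 r1' r2' => [? ?] [? ?] /= r1 r2 r1' r2' e1 e2.
by congr pair; lia.
Qed.

Let blk_mass k : \sum_(i in blk k) region_mean (reg i).2 <= 25 * (11 / 4) :> R.
Proof.
rewrite big_imset /=; last by move=> ? ? _ _; exact: place_inj.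
rewrite (eq_bigl xpredT); last by move=> j; rewrite inE.
rewrite -(pair_bigA _ (fun (_ : 'I_5 * 'I_5) b => region_mean b)) /=.
rewrite big_bool /= sumr_const card_prod card_ord /region_mean -mulr_natl; lra.
Qed.

(** Exponential Markov bound: an empty core contributes 1, and a block count of at least 189 makes
    the exponent nonnegative. *)
Let bad_counts_weight_ge1 M (f : {ffun T -> 'I_M}) : bad_counts (fun i => f i) ->
  1 <= \prod_k ((f (z k) == 0%N :> nat)%:R +
    expR (((\sum_(i in blk k) (f i : nat))%N%:R - 189) / 25)) :> R.
Proof.
move=> /forallP bf; elim/big_ind: _ => [//|x y|k _]; first exact: mulr_ege1.
have /orP[/eqP ->|h] := bf k.
  by rewrite eqxx lerDl expR_ge0.
rewrite -[leLHS]expR0 -[leLHS]add0r lerD // ler_expR divr_ge0 // subr_ge0.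
by rewrite ler_nat.
Qed.

(** Bounding the counts by [M] makes each stage a finite union of count events, hence measurable. *)
Definition path_bad_event : set Omega :=
  \bigcup_M [set w | exists f : T -> nat,
    [/\ forall i, (f i < M)%N, bad_counts f & counts_event S a reg f w]].

Let trunc M := \big[setU/set0]_(f : {ffun T -> 'I_M} | bad_counts (fun i => f i))
  counts_event S a reg (fun i => f i).

Let truncE M : trunc M = [set w | exists f : T -> nat,
  [/\ forall i, (f i < M)%N, bad_counts f & counts_event S a reg f w]].
Proof.
rewrite /trunc -bigcup_seq_cond; apply/seteqP; split=> w.
  by move=> [f /= /andP[_ bf] wf]; exists (fun i => f i : nat); split=> // i.
move=> [f [fM bf wf]].
have eF i : ([ffun i => Ordinal (fM i)] i : nat) = f i by rewrite ffunE.
exists [ffun i => Ordinal (fM i)] => /=.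
  rewrite mem_index_enum /=; move: bf; congr (is_true (bad_counts _)).
  by apply/funext => i; rewrite eF.
by move=> i; rewrite eF; exact: wf.
Qed.

Let measurable_trunc M : measurable (trunc M).
Proof.
by apply: bigsetU_measurable => f _; apply: measurable_counts ppS _ _ _.
Qed.

Lemma measurable_path_bad : measurable path_bad_event.
Proof.
by apply: bigcupT_measurable => M; rewrite -truncE; exact: measurable_trunc.
Qed.

(** Union bound over bad configurations, each weighted up by [bad_counts_weight_ge1], then
    [config_weight_le]. *)
Let prob_trunc M : (P (trunc M) <= (site_weight ^+ size g)%:E)%E.
Proof.
apply: le_trans (measure_bigsetU_le _ _ _ P _ _ _ _ _) _.
  by move=> f _; apply: measurable_counts ppS _ _ _.
rewrite (eq_bigr (fun f : {ffun T -> 'I_M} =>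
    (\prod_i pois (region_mean (reg i).2) (f i))%:E)); last first.
  move=> f _; apply: (prob_counts _ _ _ _ _ _ _ a_gt0 lam_a ppS); exact: reg_inj.
rewrite sumEFin lee_fin.
have -> : size g = #|K| by rewrite card_ord.
apply: le_trans (@config_weight_le _ T K (fun i => region_mean (reg i).2) blk z
  (11 / 4) (11 / 4 * (87 / 100) ^+ 2) M _ z_inj _ blk_mult blk_mass).
- rewrite big_mkcond /=; apply: ler_sum => f _.
  have p0 : 0 <= \prod_i pois (region_mean (reg i).2) (f i) :> R.
    by apply: prodr_ge0 => i _; apply: pois_ge0; exact: region_mean_ge0.
  case: ifP => bf; first by rewrite ler_peMr // bad_counts_weight_ge1.
  rewrite mulr_ge0 //; apply: prodr_ge0 => k _.
  by rewrite addr_ge0 ?expR_ge0.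
- by move=> i; exact: region_mean_ge0.
- by move=> k; rewrite reg_z.
Qed.

Lemma prob_path_bad : (P path_bad_event <= (site_weight ^+ size g)%:E)%E.
Proof.
have eU : path_bad_event = \bigcup_M trunc M.
  by apply: eq_bigcupr => M _; rewrite truncE.
have cv : P (trunc M) @[M --> \oo] --> P (\bigcup_M trunc M).
  apply: nondecreasing_cvg_mu; first exact: measurable_trunc.
    by rewrite -eU; exact: measurable_path_bad.
  move=> m n mn; rewrite subsetEset !truncE => w [f [fM bf wf]].
  by exists f; split=> // i; exact: leq_trans (fM i) mn.
rewrite eU -(cvg_lim (@ereal_hausdorff R) cv); apply: lime_le.
  by apply/cvg_ex; exists (P (\bigcup_M trunc M)).
by near=> M; exact: prob_trunc.
Unshelve. all: by end_near. Qed.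

Lemma path_bad_eventP (N : site * bool -> nat) w :
  (forall i, has_card (S w `&` region a i) (N i)) ->
  all (predC (good_site N)) g -> path_bad_event w.
Proof.
move=> NP /allP gb; exists (\max_i N (reg i)).+1 => //=.
exists (N \o reg); split.
- by move=> i /=; rewrite ltnS; exact: (leq_bigmax (F := fun i => N (reg i))).
- apply/forallP => k; have := gb (v k) (mem_nth _ (ltn_ord k)).
  rewrite /= /good_site negb_and -leqNgt leqn0 -ltnNge reg_z => /orP[->//|h].
  apply/orP; right; apply: leq_trans h _.
  rewrite big_imset /=; last by move=> ? ? _ _; exact: place_inj.
  rewrite [X in (_ <= X)%N](eq_bigl xpredT); last by move=> j; rewrite inE.
  by apply: leq_sum => j _; rewrite /= reg_place.
- by move=> i; exact: NP.
Qed.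

End one_path.
End bad_paths.

(** * Borel-Cantelli and the infinite cluster *)

Section borel_cantelli.
Variables (R : realType) (d : measure_display) (Omega : measurableType d).
Variables (P : probability Omega R) (lam : R) (S : Omega -> set (pt R)) (a : R).
Hypothesis a_gt0 : 0 < a.
Hypothesis lam_a : lam * a ^+ 2 = 11 / 4.
Hypothesis ppS : poisson_pp P lam S.

(** [4] is the largest offset inside a block. *)
Let radius (g : seq site) : nat := (\max_(v <- g) (v.1 + v.2) + 4)%N.

Let radius_bound (g : seq site) v :
  v \in g -> (v.1 + 4 <= radius g)%N /\ (v.2 + 4 <= radius g)%N.
Proof.
move=> vg; rewrite /radius !leq_add2r.
have vmax := @leq_bigmax_seq _ g xpredT (fun u : site => u.1 + u.2)%N v vg isT.
by split; apply: leq_trans vmax; [exact: leq_addr|exact: leq_addl].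
Qed.

(** The shift to [r.+1] keeps the start of a walk off the axis [x = 0]; each walk has [r + 2]
    sites. *)
Definition bad_axis_event (r : nat) : set Omega :=
  \big[setU/set0]_(g <- axis_walks r.+1 | uniq g) path_bad_event R d Omega S a g (radius g).

Lemma measurable_bad_axis r : measurable (bad_axis_event r).
Proof.
by apply: bigsetU_measurable => g ug; apply: measurable_path_bad ppS _ _.
Qed.

Let w := site_weight R.

Let w_gt0 : 0 < w.
Proof. by rewrite /w /site_weight addr_gt0 ?expR_gt0. Qed.

Lemma prob_bad_axis r : (P (bad_axis_event r) <= (6 * w ^+ 2 * (5 * w) ^+ r)%:E)%E.
Proof.
apply: le_trans (measure_bigsetU_le _ _ _ P _ _ _ _ _) _.
  by move=> g ug; apply: measurable_path_bad ppS _ _.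
apply: (@le_trans _ _ (\sum_(g <- axis_walks r.+1) (w ^+ r.+2)%:E)%E).
  rewrite big_mkcond /= big_seq [leRHS]big_seq; apply: lee_sum => g gr.
  case: ifP => ug; last by rewrite lee_fin exprn_ge0 // ltW.
  rewrite -(size_mem_axis_walks r.+1 g isT gr).
  by apply: (prob_path_bad _ _ _ _ _ _ _ a_gt0 lam_a ppS) => // v; exact: radius_bound.
rewrite sumEFin lee_fin big_const_seq count_predT iter_addr_0 -[leLHS]mulr_natl.
apply: (@le_trans _ _ ((6 * 5 ^ r)%N%:R * w ^+ r.+2)).
  by rewrite ler_wpM2r ?exprn_ge0 ?(ltW w_gt0) // ler_nat; exact: size_axis_walks.
rewrite natrM natrX exprMn (exprD w 2 r) le_eqVlt; apply/orP; left; apply/eqP.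
by ring.
Qed.

(** The probabilities are dominated by a geometric series of ratio [5 * w < 1]. *)
Lemma bad_axis_limsup0 : P (lim_sup_set bad_axis_event) = 0%E.
Proof.
apply: lim_sup_set_cvg0; first exact: measurable_bad_axis.
have w1 : 5 * w < 1 := bad_weight_lt R.
have c0 : 0 <= 6 * w ^+ 2 by rewrite mulr_ge0 // exprn_ge0 // ltW.
apply: (@le_lt_trans _ _ (6 * w ^+ 2 / (1 - 5 * w))%:E); last exact: ltry.
apply: lime_le; first by apply: is_cvg_nneseries => n _ _; exact: measure_ge0.
near=> n.
apply: (@le_trans _ _ (\sum_(0 <= i < n) (6 * w ^+ 2 * (5 * w) ^+ i)%:E)%E).
  by apply: lee_sum => i _; exact: prob_bad_axis.
rewrite sumEFin lee_fin; apply: geometric_le_lim => //.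
  by rewrite mulr_gt0.
by rewrite gtr0_norm ?mulr_gt0.
Unshelve. all: by end_near. Qed.

(** Without an infinite cluster all good clusters are finite, so [peierls] gives bad walks starting
    beyond every [n], and the outcome lies in the null limsup. *)
Lemma ae_infinite_cluster k : (188 < k)%N ->
  {ae P, forall w, has_infinite_cluster (S w) k}.
Proof.
move=> k_gt.
have nE : P.-negligible (lim_sup_set bad_axis_event).
  apply/negligibleP; last exact: bad_axis_limsup0.
  apply: bigcapT_measurable => n; apply: bigcup_measurable => r _.
  exact: measurable_bad_axis.
have nC := ae_has_card _ _ _ _ _ _ _ a_gt0 lam_a ppS.
apply: negligibleS (negligibleU nC nE) => om nc.
have [[N NP]|] := pselect (exists N : site * bool -> nat,
  forall i, has_card (S om `&` region a i) (N i)); last by left.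
right => n _ /=.
have fin v : finite_set [set u | joined adj4 (good_site N) v u].
  apply: contrapT => inf; apply: nc.
  exact: (infinite_good_cluster _ _ a_gt0 _ _ _ NP k_gt _ inf).
have [r0 [nr [g [gr ug gb]]]] := peierls _ fin n.
(* [n < r0] makes [r0] a successor [r.+1] with [n <= r], matching the index shift of
   [bad_axis_event]. *)
case: r0 nr gr => // r nr gr.
exists r => //; rewrite /bad_axis_event -bigcup_seq_cond.
exists g; first by rewrite /= gr.
by apply: path_bad_eventP gb => // v; exact: radius_bound.
Qed.

End borel_cantelli.

(* k_c(2) <= 188: for every k > 188, NN(2,k) on a homogeneous Poisson
   process of any intensity lam > 0 a.s. has an infinite cluster. *)
Theorem theorem1 (R : realType) (d : measure_display) (Omega : measurableType d)
  (P : probability Omega R) (lam : R) (S : Omega -> set (pt R)) (k : nat) :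
  0 < lam -> poisson_pp P lam S -> (188 < k)%N ->
  {ae P, forall w, has_infinite_cluster (S w) k}.
Proof.
move=> lam_gt0 ppS k_gt.
have q_gt0 : 0 < 11 / 4 / lam by rewrite divr_gt0.
apply: (@ae_infinite_cluster _ _ _ _ lam S (Num.sqrt (11 / 4 / lam))) => //.
  by rewrite sqrtr_gt0.
by rewrite sqr_sqrtr ?ltW // mulrC divfK // gt_eqF.
Qed.
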